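(* Fix a dimension $d \ge 1$. There is a constant $c_d > 0$ such that for every arrangement $H$ of $n$ hyperplanes in general position in $\mathbb{R}^d$, there exists a subset $S \subseteq H$ with $|S| \le n - c_d\, n^{1/d}$ such that every cell of the arrangement is bounded by at least one hyperplane in $S$.
   Context: The cells of an arrangement $H$ of hyperplanes in $\mathbb{R}^d$ are the connected components of $\mathbb{R}^d\setminus\bigcup_{h\in H} h$. A cell is bounded by a hyperplane $h$ if $h$ contains a $(d-1)$-dimensional facet of the closure of the cell. General position means that every $k\le d$ hyperplanes intersect in an affine subspace of dimension $d-k$ and no $d+1$ of them have a common point.
   Formalization: The formal theorem assumes n ≥ 2 and excludes the case d = 1, n = 2; in exactly these excluded cases (n = 0, n = 1, and d = 1 with n = 2) the claim as stated fails for every arrangement. *)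

(* Defs.v *)
From HB Require Import structures.
From mathcomp Require Export all_boot all_order all_algebra finmap.
From mathcomp Require Export all_classical all_reals all_analysis.

Set Implicit Arguments.
Unset Strict Implicit.
Unset Printing Implicit Defensive.

Import Order.TTheory GRing.Theory Num.Theory.
Import numFieldNormedType.Exports.

Local Open Scope classical_set_scope.
Local Open Scope ring_scope.

Section Arrangements.
Context {R : realType} {d : nat}.

Local Notation point := 'rV[R]_d.

Implicit Types (A P F C : set point) (H : {fset (set point)}).

(* The empty set is not an affine subspace of any dimension. *)
Definition affine_subspace (m : nat) A : Prop :=
  exists (p : point) (V : {vspace point}),
    \dim V = m /\ A = [set p + v | v in [set v : point | v \in V]].

(* Meaningful for 1 <= d only, because of the truncated predecessor. *)
Definition hyperplane A : Prop := affine_subspace d.-1 A.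

Definition affine_hull A : set point :=
  \bigcap_(B in [set B | (exists m, affine_subspace m B) /\ A `<=` B]) B.

Definition has_dimension (m : nat) A : Prop :=
  affine_subspace m (affine_hull A).

Definition dotp (a x : point) : R := \sum_(i < d) a 0 i * x 0 i.

(* F is cut out of P by a valid inequality <a, x> <= b; the improper faces
   (a = 0) are included. *)
Definition face P F : Prop :=
  exists (a : point) (b : R),
    (forall x, P x -> dotp a x <= b) /\ F = P `&` [set x | dotp a x = b].

(* A facet in the sense of a full-dimensional P: a face of dimension d - 1. *)
Definition facet P F : Prop := face P F /\ has_dimension d.-1 F.

Definition arrangement H : Prop := forall h, h \in H -> hyperplane h.

Definition general_position H : Prop :=
  (forall K : {fset (set point)}, (K `<=` H)%fset -> (#|` K| <= d)%N ->
     affine_subspace (d - #|` K|) (\bigcap_(h in [set` K]) h)) /\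
  (forall K : {fset (set point)}, (K `<=` H)%fset -> #|` K| = d.+1 ->
     \bigcap_(h in [set` K]) h = set0).

Definition arr_complement H : set point :=
  ~` (\bigcup_(h in [set` H]) h).

Definition cell H C : Prop :=
  exists2 x, arr_complement H x & C = connected_component (arr_complement H) x.

Definition bounded_by C (h : set point) : Prop :=
  exists2 F, facet (closure C) F & F `<=` h.

End Arrangements.

(* Main.v *)
(** Cells are encoded by their sign vectors ("topes"). If flipping the sign of
    [h] in the sign vector of a cell gives another realizable sign vector, then
    [h] bounds the cell. Let [T] be a maximal set of hyperplanes such that every
    cell has a flip outside [T], and take [S] to be the complement of [T].

    By maximality each [h] outside [T] comes with a cell whose only flip outside
    [T] is [h], so [n - |T|] is at most the number of cells with at most one
    flip outside [T]. This number is bounded by deletion and restriction: let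
    [t] be in [T]. If [t] is not a flip of such a cell, then the cell survives
    the deletion of [t] with the same flips; otherwise it has a facet on [t],
    which is such a cell of the arrangement induced on the hyperplane [t]. In
    dimension [e] this gives the bound [2 (2 |T| + 1)^e], hence
    [n <= (9 |T|)^d]. *)

Require Import Defs.
From mathcomp Require Import zify ring lra.

Set Implicit Arguments.
Unset Strict Implicit.
Unset Printing Implicit Defensive.

Import Order.TTheory GRing.Theory Num.Theory.
Import numFieldNormedType.Exports.

Local Open Scope ring_scope.

(** * Sign vectors as finite sets, and the change of one sign *)

Section Flip.
Variable I : finType.
Implicit Types (s t : {set I}) (i j : I).

Definition flip s i : {set I} := [set k | (k \in s) (+) (k == i)].

Lemma in_flip s i k : (k \in flip s i) = (k \in s) (+) (k == i).
Proof. by rewrite inE. Qed.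

Lemma neq_mem_set s t : s <> t -> exists i, (i \in s) != (i \in t).
Proof.
move=> st; apply/existsP; apply: contra_notT st => /existsPn h.
by apply/setP => i; apply/eqP; rewrite -[_ == _]negbK h.
Qed.

End Flip.

(** * Strict signs along segments and under small perturbations *)

Section Side.
Variable R : realFieldType.
Implicit Types (x y : R) (b : bool).

Definition side b x : bool := if b then 0 < x else x < 0.

Lemma side_pos x : x != 0 -> side (0 < x) x.
Proof. by rewrite /side; case: ltgtP. Qed.

Lemma side_inj b c x : side b x -> side c x -> b = c.
Proof. by rewrite /side; case: b; case: c => //; lra. Qed.

Lemma side_conv b x y s : 0 <= s <= 1 -> side b x -> side b y ->
  side b (x + s * (y - x)).
Proof. by rewrite /side => /andP[s0 s1]; case: b => hx hy; nra. Qed.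

Lemma side_neq0 b x : side b x -> x != 0.
Proof. by rewrite /side; case: b; lra. Qed.

(** An affine function of the parameter with values of opposite sign at 0 and 1 has its only zero at
    [x / (x - y)]. The signs are given for all parameters so that two crossings can be compared. *)
Lemma side_cross b c x y : side b x -> side c y -> b != c ->
  exists u, [/\ 0 < u < 1, x + u * (y - x) = 0,
    forall e, e < u -> side b (x + e * (y - x))
  & forall e, u < e -> side c (x + e * (y - x))].
Proof.
move=> hx hy bc; have xy : x - y != 0.
  by move: hx hy bc; rewrite /side; case: b; case: c => //= *; lra.
have uE : x / (x - y) * (x - y) = x by rewrite divfK.
exists (x / (x - y)); move: (x / (x - y)) uE => u uE.
by move: hx hy bc; rewrite /side; case: b; case: c => //= hx hy _; split;
  try (move=> e he); nra.
Qed.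

Lemma perturb_side (I : finType) (g c : I -> R) :
  exists2 e, 0 < e & forall k b, side b (g k) -> side b (g k + e * c k).
Proof.
(* This sum dominates every ratio, so one [e] serves all [k]. If [g k = 0] the ratio is 0 by
   convention; such a [k] has no strict side to preserve. *)
pose S := \sum_k `|c k| / `|g k|.
have S0 : 0 <= S by apply: sumr_ge0 => k _; rewrite divr_ge0.
exists (1 + S)^-1; first by rewrite invr_gt0; lra.
move=> k b gb; have g0 : 0 < `|g k| by rewrite normr_gt0 (side_neq0 gb).
have kS : `|c k| / `|g k| <= S.
  by rewrite /S (bigD1 k) //= lerDl sumr_ge0 // => j _; rewrite divr_ge0.
have : `|(1 + S)^-1 * c k| < `|g k|.
  rewrite normrM ger0_norm ?invr_ge0; last lra.
  rewrite mulrC ltr_pdivrMr; last lra.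
  have : `|c k| <= S * `|g k| by rewrite -ler_pdivrMr.
  by nra.
rewrite ltr_norml; move: gb; rewrite /side; case: b => gb.
  by rewrite gtr0_norm// => /andP[]; lra.
by rewrite ltr0_norm// => /andP[]; lra.
Qed.

End Side.

(** * Realizable sign vectors of a simple arrangement *)

Section Topes.
Variables (R : realFieldType) (E : lmodType R) (I : finType) (d : nat).
Variables (l : I -> E -> R) (b : I -> R).
Hypothesis l_lin : forall i k x y, l i (k *: x + y) = k * l i x + l i y.
Implicit Types (Q X T L s : {set I}) (x y v : E) (i j k : I).

Let f i x := l i x - b i.

(** General position in linear form, in three hypotheses: up to [d] normals are independent, no
    [d + 1] hyperplanes meet, and [d] normals separate vectors. *)
Hypothesis transverse : forall Q i, (#|Q| < d)%N -> i \notin Q ->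
  exists2 v, (forall q, q \in Q -> l q v = 0) & l i v = 1.
Hypothesis simple_vertex : forall Q i x, #|Q| = d -> i \notin Q ->
  (forall q, q \in Q -> f q x = 0) -> f i x <> 0.
Hypothesis direction0 : forall Q v, #|Q| = d ->
  (forall q, q \in Q -> l q v = 0) -> v = 0.

Let fE i x v e : f i (x + e *: v) = f i x + e * l i v.
Proof. by rewrite /f [x + _]addrC l_lin; ring. Qed.

Let lB i x y : l i (y - x) = f i y - f i x.
Proof. by rewrite -[- x]scaleN1r [y + _]addrC l_lin /f; ring. Qed.

Definition tope_at Q X s x : Prop :=
  (forall q, q \in Q -> f q x = 0) /\
  (forall i, i \in X -> side (i \in s) (f i x)).

(* Sign vectors, represented by their positive part, of the arrangement [X]
   induced on the flat cut out by [Q]. *)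
Definition topes Q X : {set {set I}} :=
  [set s : {set I} | (s \subset X) && `[< exists x, tope_at Q X s x >]].

Lemma topesP Q X s :
  reflect (s \subset X /\ exists x, tope_at Q X s x) (s \in topes Q X).
Proof. by rewrite inE; apply: (iffP andP) => -[h] /asboolP. Qed.

(** The point [x] is moved inside the flat of [Q] off the hyperplanes of [X] through it, one at a
    time, by steps too small to change a strict sign. *)
Lemma generic Q X x : (#|Q| < d)%N -> [disjoint Q & X] ->
  (forall q, q \in Q -> f q x = 0) ->
  exists2 s, s \in topes Q X &
    forall k c, k \in X -> side c (f k x) -> (k \in s) = c.
Proof.
move=> Qd QX xQ.
suff [y [yQ yX yx]] : exists y, [/\ forall q, q \in Q -> f q y = 0,
    forall k, k \in X -> f k y != 0
  & forall k c, side c (f k x) -> side c (f k y)].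
  exists [set k in X | 0 < f k y].
    apply/topesP; split; first by apply/fintype.subsetP => k; rewrite inE => /andP[].
    by exists y; split=> // i iX; rewrite inE iX /=; exact/side_pos/yX.
  move=> k c kX /yx; rewrite inE kX /= => h.
  by apply: side_inj h; exact/side_pos/yX.
have [n] := ubnP #|[set k in X | f k x == 0]|; elim: n x xQ => // n IHn x xQ.
case: (set_0Vmem [set k in X | f k x == 0]) => [Z0 _|[i]].
  exists x; split=> // k kX; apply/negP => fk.
  by move/setP/(_ k): Z0; rewrite !inE kX fk.
rewrite inE => /andP[iX /eqP fi0] lt_n.
have iQ : i \notin Q by apply: contraTN iX => iQ; rewrite (disjointFr QX iQ).
have [v vQ vi] := transverse Qd iQ.
have [e e0 he] := perturb_side (fun k => f k x) (fun k => l k v).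
have [||y [yQ yX yx]] := IHn (x + e *: v).
- by move=> q qQ; rewrite fE xQ // vQ // mulr0 addr0.
- rewrite -ltnS; apply: leq_trans lt_n; rewrite ltnS; apply: proper_card.
  apply/properP; split.
    apply/fintype.subsetP => k; rewrite !inE => /andP[-> /=]; rewrite fE.
    by apply: contraTT => /side_pos /he /side_neq0.
  exists i; first by rewrite inE iX fi0 eqxx.
  by rewrite inE iX fE fi0 vi add0r mulr1 gt_eqF.
- by exists y; split=> // k c /he; rewrite -fE => /yx.
Qed.

(** A segment from [s] to [t] can be chosen to cross [i] and [j] at different moments; between the
    two crossings exactly one of the two signs has changed. *)
Lemma tope_between Q X s t i j : (#|Q| < d)%N -> [disjoint Q & X] ->
  s \in topes Q X -> t \in topes Q X -> i \in X -> j \in X -> i != j ->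
  (i \in s) != (i \in t) -> (j \in s) != (j \in t) ->
  exists2 r, r \in topes Q X &
    (forall k, k \in X -> (k \in s) = (k \in t) -> (k \in r) = (k \in s)) /\
    ((i \in r) == (i \in s)) != ((j \in r) == (j \in s)).
Proof.
move=> Qd QX /topesP[sX [x [xQ xs]]] /topesP[tX [y0 [y0Q y0t]]] iX jX ij si sj.
have XQ k : k \in X -> k \notin Q.
  by apply: contraTN => kQ; rewrite (disjointFr QX kQ).
(* The inequality says that the zeros of [f i] and [f j] on the segment from [x] to [y] differ. *)
have [y [yQ yt cross]] : exists y, [/\ forall q, q \in Q -> f q y = 0,
    forall k, k \in X -> side (k \in t) (f k y)
  & f i x * f j y <> f j x * f i y].
  have [cr|] := pselect (f i x * f j y0 = f j x * f i y0); last by exists y0.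
  have fix0 := side_neq0 (xs _ iX); have fjx0 := side_neq0 (xs _ jX).
  have jiQ : j \notin i |: Q by rewrite in_setU1 eq_sym negb_or ij XQ.
  have ciQ : #|i |: Q| = #|Q|.+1 by rewrite cardsU1 XQ.
  have [iQd|iQd] := ltnP #|i |: Q| d.
    (* In a flat of dimension at least 2, sliding [y0] parallel to [i] changes [f j] but not [f i],
       which breaks the equality. *)
    have [v vQ vj] := transverse iQd jiQ.
    have [e e0 he] := perturb_side (fun k => f k y0) (fun k => l k v).
    exists (y0 + e *: v); split.
    - by move=> q qQ; rewrite fE y0Q // vQ ?inE ?qQ ?orbT // mulr0 addr0.
    - by move=> k kX; rewrite fE; apply: he; exact: y0t.
    - rewrite !fE vj vQ ?setU11 //.
      rewrite mulr0 addr0 mulr1 mulrDr cr => /eqP.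
      by rewrite -subr_eq0 addrAC subrr add0r mulf_eq0 (negPf fix0) gt_eqF.
  have {}iQd : #|i |: Q| = d by apply/eqP; rewrite eqn_leq iQd ciQ Qd.
  have dx : f i x - f i y0 != 0.
    by have := xs _ iX; have := y0t _ iX; move: si; rewrite /side;
      case: (i \in s); case: (i \in t) => //= _; lra.
  (* On a line, equality would put the vertex where the segment meets [i] on [j] as well, so [d + 1]
     hyperplanes would meet. *)
  exfalso.
  pose u := f i x / (f i x - f i y0).
  have /(simple_vertex iQd jiQ) : forall q, q \in i |: Q ->
      f q (x + u *: (y0 - x)) = 0.
    move=> q; rewrite in_setU1 => /orP[/eqP->|qQ]; rewrite fE lB.
      by rewrite /u; field.
    by rewrite xQ // y0Q // subrr mulr0 addr0.
  apply; rewrite fE lB /u.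
  transitivity ((f i x * f j y0 - f j x * f i y0) / (f i x - f i y0)).
    by field.
  by rewrite cr subrr mul0r.
have flat0 e q : q \in Q -> f q (x + e *: (y - x)) = 0.
  by move=> qQ; rewrite fE lB xQ // yQ // subrr mulr0 addr0.
suff [e e01 h] : exists2 e, 0 <= e <= 1 &
    (side (i \in s) (f i (x + e *: (y - x))) /\
     side (j \in t) (f j (x + e *: (y - x)))) \/
    (side (i \in t) (f i (x + e *: (y - x))) /\
     side (j \in s) (f j (x + e *: (y - x)))).
  have [r rV hr] := generic Qd QX (flat0 e); exists r => //; split.
    move=> k kX st; apply: hr => //; rewrite fE lB.
    by apply: side_conv => //; [exact: xs|rewrite st; exact: yt].
  case: h => -[hi hj]; rewrite (hr _ _ iX hi) (hr _ _ jX hj).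
    by rewrite eqxx [(j \in t) == _]eq_sym (negPf sj).
  by rewrite eqxx [(i \in t) == _]eq_sym (negPf si).
have [u [u01 u0 ult ugt]] := side_cross (xs _ iX) (yt _ iX) si.
have [w [w01 w0 wlt wgt]] := side_cross (xs _ jX) (yt _ jX) sj.
exists ((u + w) / 2); first lra.
rewrite !fE !lB; case: (ltgtP u w) => uw.
- by right; split; [apply: ugt|apply: wlt]; lra.
- by left; split; [apply: ult|apply: wgt]; lra.
exfalso; apply: cross; rewrite -uw in w0.
have u1 : 1 - u != 0 by lra.
have ui : f i x * (1 - u) = - u * f i y by lra.
have uj : f j x * (1 - u) = - u * f j y by lra.
by apply: (mulIf u1); rewrite mulrAC ui [RHS]mulrAC uj; ring.
Qed.

(** Induction on the number of signs in which [s] and [t] differ: if there are at least two, [t] is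
    replaced by a tope strictly between them. *)
Lemma topes_flip_toward Q X s t : (#|Q| < d)%N -> [disjoint Q & X] ->
  s \in topes Q X -> t \in topes Q X -> s <> t ->
  exists i, [/\ i \in X, (i \in s) != (i \in t) & flip s i \in topes Q X].
Proof.
move=> Qd QX sV.
have mX r k : r \in topes Q X -> k \in r -> k \in X.
  by move=> /topesP[/fintype.subsetP + _]; apply.
have dX r k : r \in topes Q X -> (k \in s) != (k \in r) -> k \in X.
  move=> rV; case: (boolP (k \in s)) => [/(mX _ _ sV)//|_].
  by case: (boolP (k \in r)) => // /(mX _ _ rV).
have [n] := ubnP #|[set k | (k \in s) != (k \in t)]|.
elim: n t => // n IHn t lt_n tV /[dup] st /neq_mem_set[i di].
have iX := dX _ _ tV di.
have [[j]|ti] := pselect (exists j, (j \in s) != (j \in t) /\ i != j); last first.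
  exists i; split=> //; suff -> : flip s i = t by [].
  apply/setP => k; rewrite in_flip; case: eqVneq => [->|ki].
    by move: di; case: (i \in s); case: (i \in t).
  rewrite addbF; apply: contra_notP ti => /eqP dk.
  by exists k; split=> //; rewrite eq_sym.
move=> [dj ij]; have jX := dX _ _ tV dj.
have [r rV [rst rij]] := tope_between Qd QX sV tV iX jX ij di dj.
have rsub k : (k \in s) != (k \in r) -> (k \in s) != (k \in t).
  by move=> dk; have kX := dX _ _ rV dk; apply: contraNN dk => /eqP /(rst _ kX) ->.
have [||k [kX dk fk]] := IHn r _ rV.
- rewrite -ltnS; apply: leq_trans lt_n; rewrite ltnS; apply: proper_card.
  apply/properP; split; first by apply/fintype.subsetP => k; rewrite !inE => /rsub.
  have [ri|ri] := eqVneq (i \in r) (i \in s).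
    by exists i; rewrite inE // ri eqxx.
  have [rj|rj] := eqVneq (j \in r) (j \in s).
    by exists j; rewrite inE // rj eqxx.
  by move: rij; rewrite (negPf ri) (negPf rj).
- by move=> sr; move: rij; rewrite sr !eqxx.
- by exists k; split=> //; exact: rsub.
Qed.

(** Moving across [j] parallel to all of [Q'] reaches a tope with the same signs on [Q'], so a flip
    towards it is outside [Q']. *)
Lemma topes_flip_off Q Q' X s j : [disjoint Q & X] -> s \in topes Q X ->
  (#|Q :|: Q'| < d)%N -> j \in X -> j \notin Q' ->
  exists i, [/\ i \in X, i \notin Q' & flip s i \in topes Q X].
Proof.
move=> QX sV QQ' jX jQ'.
have Qd : (#|Q| < d)%N.
  by apply: leq_ltn_trans QQ'; rewrite subset_leq_card ?finset.subsetUl.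
have jQ : j \notin Q :|: Q'.
  rewrite finset.in_setU negb_or jQ' andbT.
  by apply: contraTN jX => /(disjointFr QX) ->.
have [v vQ vj] := transverse QQ' jQ.
have /topesP[sX [x [xQ xs]]] := sV.
(* The factor -2 takes the value of [f j] to its negative. *)
have [|t tV ht] := @generic Q X (x + (- 2 * f j x) *: v) Qd QX.
  by move=> q qQ; rewrite fE xQ // vQ ?inE ?qQ // mulr0 addr0.
have tj : (j \in t) = ~~ (j \in s).
  apply: ht => //; rewrite fE vj; have := xs _ jX; rewrite /side.
  by case: (j \in s) => /=; lra.
have [|i [iX di fi]] := topes_flip_toward Qd QX sV tV.
  by move=> st; move: tj; rewrite st; case: (j \in t).
exists i; split=> //; apply: contraNN di => iQ'; rewrite eq_sym; apply/eqP.
by apply: ht => //; rewrite fE vQ ?inE ?iQ' ?orbT // mulr0 addr0; exact: xs.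
Qed.

(** * Deletion and restriction of topes *)

Lemma topes_delete Q X s t : s \in topes Q X -> s :\ t \in topes Q (X :\ t).
Proof.
move=> /topesP[sX [x [xQ xs]]]; apply/topesP; split; first exact: finset.setSD.
exists x; split=> // i; rewrite !in_setD1 => /andP[-> /=]; exact: xs.
Qed.

Lemma topes_lift Q X s t : (#|Q| < d)%N -> [disjoint Q & X] ->
  s \in topes Q (X :\ t) -> exists2 r, r \in topes Q X & r :\ t = s.
Proof.
move=> Qd QX /topesP[/fintype.subsetP sX [x [xQ xs]]].
have [r rV hr] := generic Qd QX xQ; exists r => //.
apply/setP => k; have [kX|kX] := boolP (k \in X :\ t).
  have := kX; rewrite !in_setD1 => /andP[-> kX'] /=.
  by apply: hr => //; exact: xs.
rewrite (contraNF (sX k) kX) in_setD1; apply: contraNF kX => /andP[kt kr].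
by have /topesP[/fintype.subsetP rX _] := rV; rewrite in_setD1 kt rX.
Qed.

(** A segment joining the two topes crosses only [t], and the crossing point realizes the remaining
    signs on [t]. *)
Lemma topes_restrict Q X s t : t \in X -> s \in topes Q X ->
  flip s t \in topes Q X -> s :\ t \in topes (t |: Q) (X :\ t).
Proof.
move=> tX /topesP[sX [x [xQ xs]]] /topesP[_ [y [yQ ys]]].
apply/topesP; split; first exact: finset.setSD.
have [|u [u01 u0 _ _]] := side_cross (xs _ tX) (ys _ tX).
  by rewrite in_flip eqxx addbT; case: (t \in s).
exists (x + u *: (y - x)); split=> [q|k].
  rewrite in_setU1 fE lB => /orP[/eqP->//|qQ].
  by rewrite xQ // yQ // subrr mulr0 addr0.
rewrite !in_setD1 fE lB => /andP[kt kX]; rewrite kt /=.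
apply: side_conv; [lra|exact: xs|].
by have := ys _ kX; rewrite in_flip (negPf kt) addbF.
Qed.

(** A point on [t] can be pushed off to either side, so the sign of [s] at [t] is arbitrary. *)
Lemma topes_extend Q X s t : (#|Q| < d)%N -> [disjoint Q & X] -> t \in X ->
  s \subset X -> s :\ t \in topes (t |: Q) (X :\ t) -> s \in topes Q X.
Proof.
move=> Qd QX tX sX /topesP[_ [x [xQ xs]]]; apply/topesP; split=> //.
have tQ : t \notin Q by rewrite (disjointFl QX tX).
have [v vQ vt] := transverse Qd tQ.
pose g : R := if t \in s then 1 else -1.
have [e e0 he] := perturb_side (fun k => f k x) (fun k => g * l k v).
exists (x + (e * g) *: v); split=> [q qQ|k kX].
  by rewrite fE xQ ?in_setU1 ?qQ ?orbT // vQ // mulr0 addr0.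
rewrite fE; have [->|kt] := eqVneq k t.
  by rewrite xQ ?setU11 // vt /g /side; case: (t \in s); lra.
rewrite -mulrA; apply: he; have := xs k.
by rewrite !in_setD1 kt /=; apply.
Qed.

(** * Counting topes with at most one flip in [L] *)

Lemma flipD1 s i t : i != t -> flip s i :\ t = flip (s :\ t) i.
Proof.
move=> it; apply/setP => k; rewrite !(in_setD1, in_flip).
by have [->|] := eqVneq k t; rewrite //= eq_sym (negPf it).
Qed.

Lemma eq_setD1 s r t : s :\ t = r :\ t -> (t \in s) = (t \in r) -> s = r.
Proof.
move=> /setP sr st; apply/setP => k; have [->//|kt] := eqVneq k t.
by have := sr k; rewrite !in_setD1 kt.
Qed.

(* [L] plays the role of the complement of [T] in the argument above. *)
Definition low_topes Q X L : {set {set I}} :=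
  [set s in topes Q X | #|[set h in L | flip s h \in topes Q X]| <= 1]%N.

Lemma in_low_topes Q X L s : (s \in low_topes Q X L) =
  (s \in topes Q X) && (#|[set h in L | flip s h \in topes Q X]| <= 1)%N.
Proof. by rewrite finset.in_set. Qed.

(** Topes not flippable at [t] inject into the deletion. The flippable ones, for each of the two
    signs at [t], inject into the restriction, hence the factor 2. *)
Lemma low_topes_step Q X L t : (#|Q| < d)%N -> [disjoint Q & X] ->
  L \subset X -> t \in X -> t \notin L ->
  (#|low_topes Q X L| <= #|low_topes Q (X :\ t) L|
                         + 2 * #|low_topes (t |: Q) (X :\ t) L|)%N.
Proof.
move=> Qd QX /fintype.subsetP LX tX tL.
have Lt h : h \in L -> h != t by apply: contraTneq => ->.
pose V := topes Q X.
pose A := [set s in low_topes Q X L | flip s t \notin V].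
pose B c := [set s in low_topes Q X L | (flip s t \in V) && ((t \in s) == c)].
have cA : (#|A| <= #|low_topes Q (X :\ t) L|)%N.
  rewrite -(card_in_imset (f := fun s => s :\ t) (D := A)).
    apply: subset_leq_card; apply/fintype.subsetP => _ /imsetP[s + ->].
    rewrite finset.in_set in_low_topes -andbA => /and3P[sV s1 st].
    rewrite in_low_topes.
    rewrite topes_delete //=; apply: leq_trans s1; apply: subset_leq_card.
    apply/fintype.subsetP => h; rewrite 2!finset.in_set => /andP[hL]; rewrite hL /=.
    move=> /(topes_lift Qd QX)[r rV rs].
    (* Apart from [t], the topes [s] and [r] differ only at [h]. A flip of [s] towards [r] is not
       [t], so it is [h]: deletion creates no new flips in [L]. *)
    have sr i : i != t -> (i \in s) != (i \in r) -> i = h.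
      move=> it; have := congr1 (fun s : {set I} => i \in s) rs.
      rewrite in_setD1 in_flip in_setD1 it /= => ->.
      by case: (eqVneq i h) => // _; rewrite addbF eqxx.
    have [|i [iX di fi]] := topes_flip_toward Qd QX sV rV.
      move=> srE; have := congr1 (fun s : {set I} => h \in s) rs.
      by rewrite -srE in_flip in_setD1 eqxx Lt //=; case: (h \in s).
    by rewrite -(sr i) //; apply: contraNneq st => <-.
  move=> s r; rewrite ![_ \in A]finset.in_set !in_low_topes -!andbA.
  move=> /and3P[sV _ st] /and3P[rV _ rt] srt.
  (* Two topes that differ only at [t] are flips of each other there, which is excluded in [A]. *)
  apply: (eq_setD1 srt); apply/eqP; apply: contraNT st => srt'.
  suff -> : flip s t = r by [].
  apply: (eq_setD1 (t := t)); last first.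
    by rewrite in_flip eqxx; move: srt'; case: (t \in s); case: (t \in r).
  rewrite -srt; apply/setP => k; rewrite !in_setD1 in_flip.
  by case: eqVneq => //= _; rewrite addbF.
have cB c : (#|B c| <= #|low_topes (t |: Q) (X :\ t) L|)%N.
  rewrite -(card_in_imset (f := fun s => s :\ t) (D := B c)).
    apply: subset_leq_card; apply/fintype.subsetP => _ /imsetP[s + ->].
    rewrite finset.in_set in_low_topes -andbA => /and4P[sV s1 st _].
    rewrite in_low_topes.
    rewrite topes_restrict //=; apply: leq_trans s1; apply: subset_leq_card.
    apply/fintype.subsetP => h; rewrite 2!finset.in_set => /andP[hL]; rewrite hL /=.
    rewrite -flipD1 ?Lt //; apply: topes_extend => //.
    have /topesP[/fintype.subsetP sX _] := sV; apply/fintype.subsetP => k.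
    rewrite in_flip; have [->|_] := eqVneq k h; first by rewrite LX.
    by rewrite addbF; exact: sX.
  move=> s r; rewrite ![_ \in B _]finset.in_set.
  move=> /and3P[_ _ /eqP sc] /and3P[_ _ /eqP rc] srt.
  by apply: (eq_setD1 srt); rewrite sc rc.
have sub : low_topes Q X L \subset A :|: (B true :|: B false).
  apply/fintype.subsetP => s sl; rewrite !finset.in_setU.
  rewrite [_ \in A]finset.in_set ![_ \in B _]finset.in_set sl /=.
  by case: (flip s t \in V); case: (t \in s).
apply: leq_trans (subset_leq_card sub) _.
apply: leq_trans (leq_card_setU _ _) _; rewrite leq_add // mul2n -addnn.
by apply: leq_trans (leq_card_setU _ _) _; rewrite leq_add.
Qed.

Lemma low_topes_dim0 Q X L : #|Q| = d -> (#|low_topes Q X L| <= 1)%N.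
Proof.
move=> Qd; apply/card_le1_eqP => s r.
rewrite 2!in_low_topes => /andP[+ _] /andP[+ _].
move=> /topesP[/fintype.subsetP sX [x [xQ xs]]].
move=> /topesP[/fintype.subsetP rX [y [yQ yr]]].
have yx : y = x.
  apply/eqP; rewrite -subr_eq0; apply/eqP; apply: (direction0 Qd) => q qQ.
  by rewrite lB xQ // yQ // subrr.
apply/setP => k; have [kX|kX] := boolP (k \in X).
  by apply: (side_inj (x := f k x)); [rewrite -yx; exact: yr|exact: xs].
by rewrite (contraNF (sX k) kX) (contraNF (rX k) kX).
Qed.

(** Every tope has a flip [k], and in dimension at least 2 there is still room to find a second one
    while avoiding [k]. *)
Lemma low_topes_dim2 Q X : (#|Q|.+1 < d)%N -> [disjoint Q & X] ->
  (1 < #|X|)%N -> low_topes Q X X = finset.set0.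
Proof.
move=> Qd QX /card_gt1P[i [j [iX jX ij]]]; apply/setP => s.
rewrite finset.in_set0; apply/negP; rewrite in_low_topes => /andP[sV]; apply/negP.
rewrite -ltnNge; apply/card_gt1P.
have [||k [kX _ fk]] := topes_flip_off (Q' := finset.set0) QX sV _ iX.
- by rewrite finset.setU0 ltnW.
- by rewrite finset.in_set0.
have [m mX mk] : exists2 m, m \in X & m \notin [set k].
  have [ki|ki] := eqVneq k i; last by exists i; rewrite // finset.in_set1 eq_sym.
  by exists j; rewrite // finset.in_set1 ki eq_sym.
have [|k' [k'X k'k fk']] := topes_flip_off (Q' := [set k]) QX sV _ mX mk.
  by rewrite finset.setUC cardsU1; apply: leq_ltn_trans Qd; case: (_ \notin _).
rewrite finset.in_set1 eq_sym in k'k.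
by exists k, k'; rewrite 2!finset.in_set kX k'X fk fk'.
Qed.

(* On a line, a cell between two others has two walls, one on each side. *)
Lemma low_topes_dim1 Q X : #|Q|.+1 = d -> [disjoint Q & X] ->
  (#|low_topes Q X X| <= 2)%N.
Proof.
move=> Qd QX; have Qd' : (#|Q| < d)%N by rewrite -Qd.
rewrite leqNgt; apply/negP => /card_gt2P[s1 [s2 [s3 []]]].
move=> [+ + +] [s12 s23 s31].
rewrite 3!in_low_topes => /andP[V1 l1] /andP[V2 l2] /andP[V3 l3].
have /topesP[_ [x1 [Q1 S1]]] := V1.
have /topesP[_ [x2 [Q2 S2]]] := V2.
have /topesP[_ [x3 [Q3 S3]]] := V3.
have [i [iX _ _]] := topes_flip_toward Qd' QX V1 V2 (elimN eqP s12).
have iQ : #|i |: Q| = d by rewrite cardsU1 (disjointFl QX iX) -Qd.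
(* The value of [f i] is a coordinate on the line: together with [Q] it fixes the point. *)
have same s r x y : s \in topes Q X -> r \in topes Q X ->
    tope_at Q X s x -> tope_at Q X r y -> f i x = f i y -> s = r.
  move=> sV rV [xQ xs] [yQ yr] xy.
  have {xy yQ xQ}yx : y = x.
    apply/eqP; rewrite -subr_eq0; apply/eqP; apply: (direction0 iQ) => q.
    rewrite lB in_setU1 => /orP[/eqP->|qQ]; first by rewrite xy subrr.
    by rewrite xQ // yQ // subrr.
  apply/eqP/negP => /negP/eqP/(topes_flip_toward Qd' QX sV rV)[k [kX + _]].
  by have := yr _ kX; rewrite yx => /(side_inj (xs _ kX)) ->; rewrite eqxx.
(* The middle tope has a flip towards each neighbour. If both were [j], the outer points would lie
   on the same side of [j] and the middle one on the other, against convexity. *)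
have mid s r t x y z : s \in topes Q X -> r \in topes Q X -> t \in topes Q X ->
    tope_at Q X s x -> tope_at Q X r y -> tope_at Q X t z -> s <> r -> r <> t ->
    (#|[set h in X | flip r h \in topes Q X]| <= 1)%N ->
    f i x < f i y -> f i y < f i z -> False.
  move=> sV rV tV [xQ xs] [yQ yr] [zQ zt] sr rt + xy yz; apply/negP.
  rewrite -ltnNge; apply/card_gt1P.
  have [//|j [jX dj fj]] := topes_flip_toward Qd' QX rV sV.
    by move=> rs; exact: sr.
  have [//|k [kX dk fk]] := topes_flip_toward Qd' QX rV tV.
  exists j, k; rewrite 2!finset.in_set jX kX fj fk; split=> //.
  apply: contraTneq dk => <-; apply/negP => dj'.
  pose u := (f i y - f i x) / (f i z - f i x).
  have u01 : 0 <= u <= 1.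
    rewrite /u ler_pdivlMr ?ler_pdivrMr; lra.
  have yE : x + u *: (z - x) = y.
    apply/eqP; rewrite -subr_eq0; apply/eqP; apply: (direction0 iQ) => q.
    rewrite lB fE lB in_setU1 => /orP[/eqP->|qQ]; last first.
      by rewrite xQ // yQ // zQ // !subrr mulr0 addr0 subrr.
    by rewrite /u; field; rewrite subr_eq0 gt_eqF // (lt_trans xy).
  have ts : (j \in t) = (j \in s).
    by move: dj dj'; case: (j \in r); case: (j \in s); case: (j \in t).
  have zj := zt _ jX; rewrite ts in zj.
  have := side_conv u01 (xs _ jX) zj; rewrite -lB -fE yE => /(side_inj (yr _ jX)).
  by move=> rs; rewrite rs eqxx in dj.
have T1 : tope_at Q X s1 x1 by [].
have T2 : tope_at Q X s2 x2 by [].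
have T3 : tope_at Q X s3 x3 by [].
have n12 := elimN eqP s12; have n23 := elimN eqP s23; have n31 := elimN eqP s31.
have n21 := nesym n12; have n32 := nesym n23; have n13 := nesym n31.
have h12 : f i x1 <> f i x2 by move/(same _ _ _ _ V1 V2 T1 T2).
have h23 : f i x2 <> f i x3 by move/(same _ _ _ _ V2 V3 T2 T3).
have h31 : f i x3 <> f i x1 by move/(same _ _ _ _ V3 V1 T3 T1).
case: (ltgtP (f i x1) (f i x2)) => [c12|c12|/h12//];
  case: (ltgtP (f i x2) (f i x3)) => [c23|c23|/h23//];
  case: (ltgtP (f i x3) (f i x1)) => [c31|c31|/h31//].
- by have := lt_trans (lt_trans c12 c23) c31; rewrite ltxx.
- exact: mid V1 V2 V3 T1 T2 T3 n12 n23 l2 c12 c23.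
- exact: mid V3 V1 V2 T3 T1 T2 n31 n12 l1 c31 c12.
- exact: mid V1 V3 V2 T1 T3 T2 n13 n32 l3 c31 c23.
- exact: mid V2 V3 V1 T2 T3 T1 n23 n31 l3 c23 c31.
- exact: mid V2 V1 V3 T2 T1 T3 n21 n13 l1 c12 c31.
- exact: mid V3 V2 V1 T3 T2 T1 n32 n21 l2 c23 c12.
- by have := lt_trans c31 (lt_trans c23 c12); rewrite ltxx.
Qed.

(** Induction on the hyperplanes of [X] outside [L]. The exponent is the dimension of the flat,
    which drops by one under restriction. *)
Lemma card_low_topes Q X L : (#|Q| <= d)%N -> [disjoint Q & X] ->
  L \subset X ->
  (#|low_topes Q X L| <= 2 * (2 * #|X :\: L|).+1 ^ (d - #|Q|))%N.
Proof.
have [n] := ubnP #|X :\: L|; elim: n Q X => // n IHn Q X lt_n.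
rewrite leq_eqVlt => /orP[/eqP Qd QX LX|Qd QX LX].
  by rewrite Qd subnn expn0; apply: leq_trans (low_topes_dim0 _ _ Qd) _.
case: (set_0Vmem (X :\: L)) => [XL0|[t tXL]].
  have -> : L = X by apply/eqP; rewrite finset.eqEsubset LX -finset.setD_eq0 XL0 eqxx.
  rewrite finset.setDv cards0 exp1n.
  have [Qd2|Qd1] := ltnP #|Q|.+1 d; last first.
    by apply: low_topes_dim1 => //; apply/eqP; rewrite eqn_leq Qd.
  (* With at most one hyperplane there are at most two sign vectors altogether. *)
  have [X1|X1] := ltnP 1 #|X|; first by rewrite low_topes_dim2 // cards0.
  apply: (@leq_trans #|powerset X|).
    apply: subset_leq_card; apply/fintype.subsetP => s.
    by rewrite in_low_topes powersetE => /andP[/topesP[]].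
  by rewrite card_powerset -[leqRHS]expn1 leq_exp2l.
have := tXL; rewrite finset.in_setD => /andP[tL tX].
have XE : (X :\ t) :\: L = (X :\: L) :\ t.
  by apply/setP => k; rewrite !(finset.in_setD, finset.in_set1) andbCA.
have cXL : #|X :\: L| = #|(X :\ t) :\: L|.+1 by rewrite XE (cardsD1 t) tXL.
have LX' : L \subset X :\ t by rewrite finset.subsetD1 LX.
have tQ : t \notin Q by rewrite (disjointFl QX tX).
have ctQ : #|t |: Q| = #|Q|.+1 by rewrite cardsU1 tQ.
apply: leq_trans (low_topes_step Qd QX LX tX tL) _.
have lt_n' : (#|(X :\ t) :\: L| < n)%N by rewrite -ltnS -cXL.
have QX' : [disjoint Q & X :\ t] by apply: disjointWr QX; exact: subD1set.
have tQX' : [disjoint t |: Q & X :\ t].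
  apply/pred0P => k /=; rewrite in_setU1 in_setD1.
  by case: eqVneq => //= _; case: (boolP (k \in Q)) => // /(disjointFr QX).
have IH1 := IHn Q (X :\ t) lt_n' (ltnW Qd) QX' LX'.
have := IHn (t |: Q) (X :\ t) lt_n'; rewrite ctQ => /(_ Qd tQX' LX') IH2.
rewrite cXL; move: IH1 IH2; set m := #|(X :\ t) :\: L|.
have -> : (d - #|Q| = (d - #|Q|.+1).+1)%N by rewrite subnSK.
move: (d - #|Q|.+1)%N => e; rewrite !expnS => IH1 IH2.
(* With [q = (2m + 1)^e] the two bounds add up to [2q(2m + 1) + 4q = 2q(2m + 3)], so it remains to
   compare [q] with [(2m + 3)^e]. *)
have mono : ((2 * m).+1 ^ e <= (2 * m.+1).+1 ^ e)%N.
  by have [->//|e0] := posnP e; rewrite leq_exp2r //; lia.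
apply: leq_trans (leq_add IH1 (leq_mul (leqnn 2) IH2)) _.
by move: mono; move: ((2 * m.+1).+1 ^ e)%N ((2 * m).+1 ^ e)%N => p q; nia.
Qed.

(** * A maximal set outside which every tope keeps a flip *)

Lemma exists_large_flippable_set : (0 < d)%N -> (1 < #|I|)%N ->
  ~ (d = 1 /\ #|I| = 2)%N ->
  exists2 T : {set I}, (0 < #|T|)%N && (#|I| <= (9 * #|T|) ^ d)%N &
    forall s, s \in topes finset.set0 [set: I] ->
      exists2 h, h \notin T & flip s h \in topes finset.set0 [set: I].
Proof.
move=> d0 I1 dI; pose V := topes finset.set0 [set: I].
pose P T := [forall s in V, exists h, (h \notin T) && (flip s h \in V)].
have disj : [disjoint (finset.set0 : {set I}) & [set: I]].
  by apply/pred0P => k; rewrite /= finset.in_set0.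
have P0 : P finset.set0.
  apply/forall_inP => s sV; have /card_gt0P[i _] := ltnW I1.
  have [|||k [_ k0 fk]] :=
    topes_flip_off (Q' := finset.set0) (j := i) disj sV.
  - by rewrite finset.setU0 cards0.
  - by rewrite finset.in_setT.
  - by rewrite finset.in_set0.
  by apply/existsP; exists k; rewrite k0.
case: (@arg_maxnP _ finset.set0 P (fun T => #|T|) P0) => T PT maxT.
pose walls s := [set h in ~: T | flip s h \in V].
(* By maximality, adding [h] to [T] leaves some tope without a flip outside; its only flip outside
   [T] was therefore [h]. Distinct [h] come from distinct low topes. *)
have sub : [set [set h] | h in ~: T] \subset
    [set walls s | s in low_topes finset.set0 [set: I] (~: T)].
  apply/fintype.subsetP => _ /imsetP[h hT ->]; rewrite finset.in_setC in hT.
  have : ~~ P (h |: T).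
    by apply/negP => /maxT; rewrite /= cardsU1 hT add1n ltnn.
  case/forall_inPn => s sV /existsPn hs.
  have wsub : walls s \subset [set h].
    apply/fintype.subsetP => k.
    rewrite [_ \in walls s]finset.in_set finset.in_setC => /andP[kT fk].
    by have := hs k; rewrite fk andbT negbK in_setU1 (negPf kT) orbF finset.in_set1.
  have wE : walls s = [set h].
    apply/eqP; rewrite finset.eqEsubset wsub finset.sub1set.
    have /forall_inP/(_ s sV)/existsP[k /andP[kT fk]] := PT.
    have kw : k \in walls s by rewrite finset.in_set finset.in_setC kT.
    by have := fintype.subsetP wsub k kw; rewrite finset.in_set1 => /eqP <-.
  apply/imsetP; exists s; last by rewrite wE.
  by rewrite in_low_topes sV -/(walls s) wE cards1.
have cTC : (#|~: T| <= #|low_topes finset.set0 [set: I] (~: T)|)%N.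
  rewrite -(card_imset (~: T) (@finset.set1_inj I)).
  by apply: leq_trans (subset_leq_card sub) (leq_imset_card _ _).
have := @card_low_topes finset.set0 [set: I] (~: T).
rewrite cards0 subn0 finset.setTD finset.setCK.
move=> /(_ isT disj (finset.subsetT _)) bound.
have cI : (#|T| + #|~: T| = #|I|)%N by rewrite cardsC.
(* If [T] were empty, every hyperplane would be the sole flip of some tope: impossible for [d > 1],
   and for [d = 1] the bound 2 leaves only the excluded case. *)
have T0 : (0 < #|T|)%N.
  rewrite lt0n; apply/negP => /eqP cT0.
  move/eqP: (cT0); rewrite cards_eq0 => /eqP T0.
  have [d2|d1] := ltnP 1 d.
    move: cTC; rewrite T0 finset.setC0 low_topes_dim2 ?cards0 // ?finset.cardsT //.
    by rewrite leqn0 => /eqP I0; rewrite I0 in I1.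
  have dE : d = 1%N by apply/eqP; rewrite eqn_leq d1.
  by apply: dI; split=> //; move: bound; rewrite cT0 dE; lia.
exists T; first rewrite T0 /=.
  (* Since [T] is nonempty, [2|T| + 1 <= 3|T|], and [|T| + 2(3|T|)^d <= 3(3|T|)^d <= (9|T|)^d]. *)
  have le1 : (#|T| <= (3 * #|T|) ^ d)%N.
    by apply: leq_trans (leq_pexp2l _ d0); rewrite ?expn1; lia.
  have le2 : ((2 * #|T|).+1 ^ d <= (3 * #|T|) ^ d)%N by rewrite leq_exp2r //; lia.
  have le3 : (3 * (3 * #|T|) ^ d <= (9 * #|T|) ^ d)%N.
    have -> : (9 * #|T| = 3 * (3 * #|T|))%N by lia.
    by rewrite [leqRHS]expnMn leq_mul // -{1}[3%N]expn1 leq_pexp2l.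
  apply: leq_trans le3; rewrite -cI mulSn leq_add //.
  by apply: leq_trans cTC (leq_trans bound _); rewrite leq_mul2l.
move=> s sV; have /forall_inP/(_ s sV)/existsP[k /andP[kT fk]] := PT.
by exists k.
Qed.

End Topes.

(** * Equations of hyperplanes and dimensions of affine subspaces *)

Section Hyperplane.
Variables (R : realType) (d : nat).
Local Notation point := 'rV[R]_d.
Local Open Scope classical_set_scope.
Local Open Scope ring_scope.

Lemma dotp_linear (a : point) k x y :
  dotp a (k *: x + y) = k * dotp a x + dotp a y.
Proof.
by rewrite /dotp mulr_sumr -big_split /=; apply: eq_bigr => i _; rewrite !mxE; ring.
Qed.

Lemma dotpD (a : point) x y : dotp a (x + y) = dotp a x + dotp a y.
Proof. by rewrite -[x]scale1r dotp_linear mul1r scale1r. Qed.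

Lemma dotpZ (a : point) k x : dotp a (k *: x) = k * dotp a x.
Proof.
by rewrite /dotp mulr_sumr; apply: eq_bigr => i _; rewrite mxE; ring.
Qed.

(** The coordinate along a one-dimensional complement is a linear functional with kernel [V]; its
    values on the unit vectors form [a]. *)
Lemma vspace_kernel (V : {vspace point}) : (0 < d)%N -> \dim V = d.-1 ->
  exists a : point, forall x, (x \in V) = (dotp a x == 0).
Proof.
move=> d0 dV; have dC : \dim V^C = 1%N.
  by rewrite dimv_compl dimvf dV /dim /= mul1n -[X in (X - _)%N](prednK d0) subSnn.
pose B := vbasis V^C; pose j : 'I_(\dim V^C) := cast_ord (esym dC) ord0.
pose g x := coord B j (x - projv V x).
have g0 : g 0 = 0 by rewrite /g linear0 subr0 linear0.
have gD : {morph g : x y / x + y}.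
  by move=> x y; rewrite /g [projv V _]linearD opprD addrACA linearD.
have gZ k x : g (k *: x) = k * g x.
  by rewrite /g [projv V _]linearZ -scalerBr linearZ.
exists (\row_i g 'e_i) => x.
have -> : dotp (\row_i g 'e_i) x = g x.
  rewrite [in RHS](row_sum_delta x) (big_morph g gD g0); apply: eq_bigr => i _.
  by rewrite mxE gZ mulrC.
apply/idP/eqP => [xV|gx]; first by rewrite /g projv_id // subrr linear0.
have /coord_vbasis := memv_projC V x; rewrite big1 => [/eqP|k _].
  by rewrite subr_eq0 => /eqP ->; exact: memv_proj.
have -> : k = j.
  by apply: ord_inj; case: k => [k kC] /=; move: (kC); rewrite dC; case: k kC.
by rewrite -/(g x) gx scale0r.
Qed.

Lemma hyperplane_dotp (A : set point) : (0 < d)%N -> hyperplane A ->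
  exists ab : point * R, A = [set x | dotp ab.1 x = ab.2].
Proof.
move=> d0 [p [V [dV ->]]]; have [a aV] := vspace_kernel d0 dV.
exists (a, dotp a p) => /=; apply/seteqP; split=> x /=.
  by move=> [v + <-]; rewrite aV dotpD => /eqP ->; rewrite addr0.
move=> ax; exists (x - p); last by rewrite addrC subrK.
by rewrite aV -(inj_eq (addIr (dotp a p))) -dotpD subrK add0r ax.
Qed.

(** This extends containment near [p] to a whole hyperplane when an affine hull is computed. *)
Lemma affine_subspace_line m (A : set point) p w e : affine_subspace m A ->
  e != 0 -> A p -> A (p + e *: (w - p)) -> A w.
Proof.
move=> [q [V [_ ->]]] e0 [v1 v1V <-] [v2 /= v2V pv].
exists (v1 + e^-1 *: (v2 - v1)).
  by rewrite /= memvD // memvZ // memvB.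
have -> : v2 - v1 = e *: (w - (q + v1)).
  by apply: (addrI (q + v1)); rewrite -pv -!addrA [v1 + _]addrC subrK.
by rewrite scalerA mulVf // scale1r addrA addrC subrK.
Qed.

Lemma affine_subspace_leq_dim m1 m2 (A B : set point) : affine_subspace m1 A ->
  affine_subspace m2 B -> B `<=` A ->
  (forall p v, B p -> A (p + v) -> B (p + v)) -> (m1 <= m2)%N.
Proof.
move=> [p [V [<- AE]]] [q [W [<- BE]]] BA AB; apply: dimvS; apply/subvP => v vV.
have Bq : B q by rewrite BE; exists 0; rewrite /= ?mem0v // addr0.
have [v' v'V qE] : [set p + v | v in [set v | v \in V]] q by rewrite -AE; exact: BA.
have : B (q + v).
  by apply: AB => //; rewrite AE; exists (v' + v); rewrite /= ?memvD // addrA qE.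
by rewrite BE => -[w wW /addrI <-].
Qed.

End Hyperplane.

(** * General position expressed through normal vectors *)

Section GeneralPosition.
Variables (R : realType) (d : nat).
Local Notation point := 'rV[R]_d.
Variables (H : {fset (set point)}) (a : H -> point) (b : H -> R).
Local Open Scope classical_set_scope.
Local Open Scope ring_scope.
Hypothesis valE : forall i : H, val i = [set x | dotp (a i) x = b i].
Hypothesis gpH : general_position H.
Implicit Types (Q : {set H}) (i : H) (x v : point).

Definition fset_of Q : {fset (set point)} := [fset val i | i in Q]%fset.

Lemma fset_of_sub Q : (fset_of Q `<=` H)%fset.
Proof. by apply/fsubsetP => _ /imfsetP[i _ ->]; exact: valP. Qed.

Lemma card_fset_of Q : #|` fset_of Q| = #|Q|.
Proof. by rewrite card_imfset ?cardE //; exact: val_inj. Qed.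

Definition flat Q : set point := [set x | forall q, q \in Q -> dotp (a q) x = b q].

Lemma bigcap_fset_of Q : \bigcap_(h in [set` fset_of Q]) h = flat Q.
Proof.
apply/seteqP; split=> x /= hx.
  move=> q qQ; have /hx : [set` fset_of Q] (val q) by apply/imfsetP; exists q.
  by rewrite valE.
by move=> _ /= /imfsetP[q qQ ->]; rewrite valE; exact: hx.
Qed.

Lemma flat_affine_subspace Q : (#|Q| <= d)%N -> affine_subspace (d - #|Q|) (flat Q).
Proof.
rewrite -bigcap_fset_of -card_fset_of.
by case: gpH => h _; apply: h; exact: fset_of_sub.
Qed.

Lemma flat_eq0 Q : #|Q| = d.+1 -> flat Q = set0.
Proof.
rewrite -bigcap_fset_of -card_fset_of.
by case: gpH => _; apply; exact: fset_of_sub.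
Qed.

(** If every vector orthogonal to the normals of [Q] were orthogonal to that of [i], adding [i] to
    [Q] would not lower the dimension of the flat. *)
Lemma general_position_transverse Q i : (#|Q| < d)%N -> i \notin Q ->
  exists2 v, (forall q, q \in Q -> dotp (a q) v = 0) & dotp (a i) v = 1.
Proof.
move=> Qd iQ; have ciQ : #|i |: Q| = #|Q|.+1 by rewrite cardsU1 iQ.
have [[v vQ vi]|no] := pselect
    (exists2 v, (forall q, q \in Q -> dotp (a q) v = 0) & dotp (a i) v != 0).
  exists ((dotp (a i) v)^-1 *: v); last by rewrite dotpZ mulVf.
  by move=> q qQ; rewrite dotpZ (vQ q qQ) mulr0.
have aQ := flat_affine_subspace (ltnW Qd).
have aiQ : affine_subspace (d - #|i |: Q|) (flat (i |: Q)).
  by apply: flat_affine_subspace; rewrite ciQ.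
have : (d - #|Q| <= d - #|i |: Q|)%N.
  apply: (affine_subspace_leq_dim aQ aiQ) => [x xiQ q qQ|p v piQ pvQ q].
    by apply: xiQ; rewrite in_setU1 qQ orbT.
  rewrite in_setU1 => /orP[/eqP->|/pvQ//].
  rewrite dotpD piQ ?setU11 //.
  suff -> : dotp (a i) v = 0 by rewrite addr0.
  apply: contra_notP no => /eqP vi; exists v => // q' q'Q.
  apply: (addrI (b q')); rewrite addr0.
  by rewrite -{1}(piQ q') ?in_setU1 ?q'Q ?orbT // -dotpD pvQ.
by rewrite ciQ; lia.
Qed.

Lemma general_position_vertex Q i x : #|Q| = d -> i \notin Q ->
  (forall q, q \in Q -> dotp (a q) x - b q = 0) -> dotp (a i) x - b i <> 0.
Proof.
move=> Qd iQ xQ xi; suff : flat (i |: Q) x.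
  by rewrite flat_eq0 // cardsU1 iQ Qd.
move=> q; rewrite in_setU1 => /orP[/eqP->|/xQ]; last by move/subr0_eq.
exact: subr0_eq.
Qed.

Lemma general_position_direction Q v : #|Q| = d ->
  (forall q, q \in Q -> dotp (a q) v = 0) -> v = 0.
Proof.
move=> Qd vQ; have [|p [V [dV QE]]] := @flat_affine_subspace Q; first by rewrite Qd.
have pQ : flat Q p by rewrite QE; exists 0; rewrite /= ?mem0v // addr0.
have : flat Q (p + v) by move=> q qQ; rewrite dotpD pQ // vQ // addr0.
rewrite QE => -[w /= wV /addrI <-]; apply/eqP; rewrite -memv0.
by move: dV; rewrite Qd subnn => /eqP; rewrite dimv_eq0 => /eqP <-.
Qed.

End GeneralPosition.

(** * Cells as sign classes, and flips as facets *)

Section Cells.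
Variables (R : realType) (d : nat).
Local Notation point := 'rV[R]_d.+1.
Variables (H : {fset (set point)}) (a : H -> point) (b : H -> R).
Local Open Scope classical_set_scope.
Local Open Scope ring_scope.
Hypothesis valE : forall i : H, val i = [set x | dotp (a i) x = b i].
Implicit Types (i : H) (x y v : point).

Let f i x := dotp (a i) x - b i.

Let f_line i x y e : f i (x + e *: (y - x)) = f i x + e * (f i y - f i x).
Proof. by rewrite /f !(dotpD, dotpZ) -scaleN1r dotpZ; ring. Qed.

Lemma continuous_dotp v : continuous (dotp v).
Proof.
have cM (j : 'I_d.+1) : continuous (fun x : point => v 0 j * x 0 j).
  by move=> x; apply: continuousM; [exact: cst_continuous|exact: coord_continuous].
rewrite /dotp; elim: (index_enum _) => [|i s IHs].
  by under [X in continuous X]eq_fun do rewrite big_nil; exact: cst_continuous.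
under [X in continuous X]eq_fun do rewrite big_cons.
by move=> x; exact: (continuousD (cM i x) (IHs x)).
Qed.

Let f_cont i : continuous (f i).
Proof.
by move=> x; exact: (continuousB (@continuous_dotp _ x) (@cst_continuous _ _ _ x)).
Qed.

Lemma continuous_line x y : continuous (fun e : R => x + e *: (y - x)).
Proof.
by move=> e; apply: cvgD; [exact: cvg_cst|apply: cvgZr_tmp; exact: cvg_id].
Qed.

Lemma arr_complementP x : arr_complement H x <-> forall i, f i x != 0.
Proof.
split=> [xH i|xH [h /= hH]].
  apply/negP; rewrite subr_eq0 => /eqP xi; apply: xH.
  by exists (val i); [exact: valP|rewrite valE].
rewrite -[h]/(val (FSetSub hH)) valE /= => xh.
by have := xH (FSetSub hH); rewrite /f xh subrr eqxx.
Qed.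

Definition same_side x y := forall i, side (0 < f i x) (f i y).

(** On a component each [f i] takes an interval of values avoiding 0; conversely, the segment
    between two points with equal signs avoids all hyperplanes. *)
Lemma cell_same_side x : arr_complement H x ->
  connected_component (arr_complement H) x = same_side x.
Proof.
move=> xH; have xs : same_side x x.
  by move=> i; apply: side_pos; exact: (proj1 (arr_complementP x) xH).
apply/seteqP; split=> y.
  move=> Cy i.
  have : connected (f i @` connected_component (arr_complement H) x).
    apply: connected_continuous_connected; first exact: component_connected.
    exact: continuous_subspaceT.
  move=> /connected_intervalP itv.
  have no0 : ~ (f i @` connected_component (arr_complement H) x) 0.
    by move=> [z /connected_component_sub/arr_complementP/(_ i) /eqP].
  have Fx : (f i @` connected_component (arr_complement H) x) (f i x).
    by exists x => //; exact: connected_component_refl.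
  have Fy : (f i @` connected_component (arr_complement H) x) (f i y) by exists y.
  have := xs i; rewrite /side; case: ifPn => _ fx0.
    rewrite ltNge; apply/negP => y0; apply: no0.
    by apply: (itv _ _ Fy Fx); rewrite y0 ltW.
  rewrite ltNge; apply/negP => y0; apply: no0.
  by apply: (itv _ _ Fx Fy); rewrite y0 ltW.
move=> xy.
have sub : (fun e : R => x + e *: (y - x)) @` `[0, 1] `<=` arr_complement H.
  move=> _ [e /= /[!in_itv]/= e01 <-]; apply/arr_complementP => i.
  by rewrite f_line; apply: (side_neq0 (b := 0 < f i x)); exact: side_conv.
apply: (connected_component_max _ sub).
- by exists 0; rewrite /= ?in_itv /= ?lexx ?ler01 // scale0r addr0.
- apply: connected_continuous_connected; first exact: segment_connected.
  by apply: continuous_subspaceT; exact: continuous_line.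
- by exists 1; rewrite /= ?in_itv /= ?lexx ?ler01 // scale1r addrC subrK.
Qed.

Lemma closure_line (C : set point) u x :
  (forall e, 0 < e <= 1 -> C (u + e *: (x - u))) -> closure C u.
Proof.
move=> hC B uB.
have : \forall e \near 0^'+, B (u + e *: (x - u)).
  apply: (@cvg_at_right_filter _ _ (fun e => u + e *: (x - u)) 0 u _ B uB).
  by have := @continuous_line u x 0; rewrite /continuous_at scale0r addr0.
move=> nB; near (0 : R)^'+ => e.
exists (u + e *: (x - u)); split; last by near: e.
by apply: hC; apply/andP; split; near: e;
  [exact: nbhs_right_gt|exact: nbhs_right_le].
Unshelve. all: by end_near. Qed.

(** The segment from [x] to [y] meets only the hyperplane [i], at a point [z]. Near [z] this
    hyperplane lies in the closure of the cell, so it is the affine hull of the face it cuts out. *)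
Lemma flip_bounded_by x y i : hyperplane (val i) -> arr_complement H x ->
  side (~~ (0 < f i x)) (f i y) ->
  (forall k, k != i -> side (0 < f k x) (f k y)) ->
  bounded_by (connected_component (arr_complement H) x) (val i).
Proof.
move=> hi xH yi yk; rewrite cell_same_side //.
have xs : same_side x x.
  by move=> k; apply: side_pos; exact: (proj1 (arr_complementP x) xH).
have [|u [u01 u0 _ _]] := side_cross (xs i) yi; first by case: (0 < _).
pose z := x + u *: (y - x).
have zi : f i z = 0 by rewrite f_line.
have zk k : k != i -> side (0 < f k x) (f k z).
  by move=> ki; rewrite f_line; apply: side_conv => //; [lra|exact: yk].
pose F := closure (same_side x) `&` val i.
(* The sign [g] orients the equation so that the cell lies where [g * f i] is positive. *)
have sgn : exists2 g : R, g != 0 & 0 < g * f i x.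
  by have := xs i; rewrite /side; case: ifPn => _ h; [exists 1|exists (-1)]; lra.
have Fface : face (closure (same_side x)) F.
  have [g g0 gx] := sgn; exists (- g *: a i), (- g * b i).
  have dE w : dotp (- g *: a i) w = - g * dotp (a i) w.
    by rewrite /dotp mulr_sumr; apply: eq_bigr => k _; rewrite mxE; ring.
  split.
    move=> w Cw; rewrite dE.
    suff : 0 <= g * f i w by rewrite /f; lra.
    have : closure ((fun w => g * f i w) @^-1` [set r | 0 <= r]) w.
      apply: closure_subset Cw => v /(_ i) /=; have := xs i.
      by rewrite /side; case: ifPn => _; nra.
    apply: preimage_closed; last exact: closed_ge.
    by move=> v _; apply: continuousM; [exact: cst_continuous|exact: f_cont].
  rewrite /F valE; apply/seteqP; split=> w [Cw] /= h; split=> //=.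
    by rewrite dE h.
  by move: h; rewrite dE => /mulfI -> //; rewrite oppr_eq0.
exists F => //; last by move=> w [].
split=> //; rewrite /has_dimension; suff -> : affine_hull F = val i by [].
apply/seteqP; split=> [w hw|w iw B [[m mB] FB]].
  by apply: hw; split=> [|v []//]; exists d.+1.-1; exact: hi.
have [e e0 he] := perturb_side (fun k => f k z) (fun k => f k w - f k z).
have wi : f i w = 0 by move: iw; rewrite valE /f /= => ->; rewrite subrr.
(* The segment from such a [v] to [x] enters the cell immediately, so [v] is in the closure. *)
have inF v : f i v = 0 -> (forall k, k != i -> side (0 < f k x) (f k v)) -> F v.
  move=> vi vk; split; last by rewrite valE; apply/eqP; rewrite -subr_eq0; apply/eqP.
  apply: (@closure_line _ _ x) => t t01 k; rewrite f_line.
  have [->|ki] := eqVneq k i; last by apply: side_conv; [lra|exact: vk|exact: xs].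
  rewrite vi subr0 add0r; have := xs i; rewrite /side; case: ifPn => _ h; nra.
apply: (affine_subspace_line mB (p := z) (e := e)); first by rewrite gt_eqF.
  by apply: FB; apply: inF.
apply: FB; apply: inF => [|k ki]; first by rewrite f_line zi wi subrr mulr0 addr0.
by rewrite f_line; apply: he; exact: zk.
Qed.

End Cells.

(** * From the combinatorial bound to arrangements *)

Local Open Scope classical_set_scope.
Local Open Scope ring_scope.

Theorem theorem2 (R : realType) (d : nat) (hd : (1 <= d)%N) :
  exists2 c : R, 0 < c &
    forall (n : nat) (H : {fset (set 'rV[R]_d)}),
      arrangement H -> #|` H| = n -> general_position H ->
      (* the claim is false for n <= 1, and for n = 2 if d = 1 *)
      (1 < n)%N -> ~ (d = 1%N /\ n = 2%N) ->
      exists S : {fset (set 'rV[R]_d)},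
        [/\ (S `<=` H)%fset,
            (#|` S|)%:R <= n%:R - c * n%:R `^ (d%:R^-1)
          & forall C : set 'rV[R]_d, cell H C ->
              exists2 h, h \in S & bounded_by C h].
Proof.
(* The dimension is now [d.+1], and [9^-1] inverts the 9 in the bound [n <= (9|T|)^(d + 1)]. *)
case: d hd => // d _; exists 9^-1; first by rewrite invr_gt0.
move=> n H arrH cH gpH n1 dn.
have [ab abE] := choice (fun i : H => hyperplane_dotp (ltn0Sn d) (arrH _ (valP i))).
pose a i := (ab i).1; pose b i := (ab i).2.
have valE (i : H) : val i = [set x | dotp (a i) x = b i] by exact: abE.
have cI : #|{: H}| = n by rewrite -cardfE.
have [||T /andP[T0 TI] flipT] := exists_large_flippable_set
  (fun i => dotp_linear (a i)) (general_position_transverse valE gpH)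
  (general_position_vertex valE gpH) (general_position_direction valE gpH)
  (ltn0Sn d).
- by rewrite cI.
- by rewrite cI.
exists (fset_of (~: T)%SET); split.
- exact: fset_of_sub.
- rewrite card_fset_of.
  (* Since [S] has [n - |T|] elements, the claim amounts to the root of that bound. *)
  suff le9 : n%:R `^ d.+1%:R^-1 <= 9 * #|T|%:R :> R.
    have nE : n%:R = #|T|%:R + #|(~: T)%SET|%:R :> R by rewrite -natrD cardsC cI.
    by move: (n%:R `^ _) le9 => p le9; lra.
  have -> : 9 * #|T|%:R = ((9 * #|T|) ^ d.+1)%:R `^ d.+1%:R^-1 :> R.
    by rewrite natrX -powR_mulrn // -powRrM mulfV ?pnatr_eq0 // powRr1 // natrM.
  by apply: ge0_ler_powR; rewrite ?nnegrE ?ler_nat ?invr_ge0 -?cI.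
- move=> C [x xH ->]; have fx := proj1 (arr_complementP valE x) xH.
  have [|h hT /topesP[_ [y [_ ys]]]] := flipT [set i | 0 < dotp (a i) x - b i]%SET.
    apply/topesP; split; first exact: finset.subsetT.
    by exists x; split=> [q|i _]; rewrite ?finset.in_set0 // finset.in_set side_pos.
  exists (val h); first by apply/imfsetP; exists h => //; rewrite /= finset.in_setC.
  apply: (flip_bounded_by valE (y := y)) => //.
  + exact: arrH (valP h).
  + by have := ys h (finset.in_setT _); rewrite in_flip eqxx addbT finset.in_set.
  + move=> k kh; have := ys k (finset.in_setT _).
    by rewrite in_flip (negPf kh) addbF finset.in_set.
Qed.
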